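(* Let $(\Omega,\mathcal F)$ be a measurable space, let $\mathcal C\subset\mathcal F$ be a sub-$\sigma$-algebra, and let $\rho:\mathbb F\to\mathbb R$ be a sublinear operator which is continuous from above on $\mathcal F$ and strictly comparable, and whose representation set $\mathcal P$ is stable. Let $\xi\in\mathbb F$ and let $\eta_{ess}:=\operatorname{ess\,sup}_{P\in\mathcal P}E_P[\xi|\mathcal C]$. Then $\eta_{ess}$ is the unique (up to $P_0$-a.s. equality) solution of the optimization problem $$\inf_{\eta\in\mathbb C}\ \sup_{\tilde\eta\in\mathbb C^+}\rho\big((\xi-\eta)^2+\tilde\eta(\xi-\eta)\big),$$ i.e. the unique element $\eta\in\mathbb C$ at which the infimum is attained.
   Context: $\mathbb F$ denotes the set of all bounded $\mathcal F$-measurable real functions on $\Omega$, $\mathbb C$ the set of all bounded $\mathcal C$-measurable real functions, and $\mathbb C^+$ the set of nonnegative elements of $\mathbb C$. A sublinear operator is a functional $\rho:\mathbb F\to\mathbb R$ such that: (i) $\rho(\xi_1)\ge\rho(\xi_2)$ if $\xi_1\ge\xi_2$; (ii) $\rho(c)=c$ for $c\in\mathbb R$; (iii) $\rho(\xi_1+\xi_2)\le\rho(\xi_1)+\rho(\xi_2)$ for all $\xi_1,\xi_2\in\mathbb F$; (iv) $\rho(\lambda\xi)=\lambda\rho(\xi)$ for $\lambda\ge0$. $\rho$ is continuous from above on $\mathcal F$ if for each sequence $(\xi_n)\subset\mathbb F$ with $\xi_n\downarrow0$ one has $\rho(\xi_n)\downarrow0$. $\mathcal P$ (the representation set of $\rho$)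 denotes the set of all linear functionals on $\mathbb F$ dominated by $\rho$. When $\rho$ is continuous from above, every element of $\mathcal P$ is the expectation $E_P$ under a probability measure $P$ on $(\Omega,\mathcal F)$ (and is identified with $P$), $\rho(\xi)=\sup_{P\in\mathcal P}E_P[\xi]$ for $\xi\in\mathbb F$, and there is a probability measure $P_0$ on $(\Omega,\mathcal F)$ such that every $P\in\mathcal P$ is absolutely continuous with respect to $P_0$ and $\{dP/dP_0:P\in\mathcal P\}$ is $\sigma(L^1(P_0),L^\infty(P_0))$-compact; such a $P_0$ is fixed, and the essential supremum is taken with respect to $P_0$. $\rho$ is strictly comparable if for all $\xi_1,\xi_2\in\mathbb F$ satisfying $\xi_1>\xi_2$ $P_0$-a.s. one has $\rho(\xi_1)>\rho(\xi_2)$. Stability: the space $(\Omega,\mathcal F,P_0)$ is equipped with a filtration $(\mathcal F_n)_{n\ge1}$ such that $\mathcal F=\bigvee_n\mathcal F_n$. Let $\mathcal P^e$ be the set of elements of $\mathcal P$ equivalent to $P_0$, and for $Q\in\mathcal P^e$ put $Z^Q_n=E_{P_0}[dQ/dP_0|\mathcal F_n]$. $\mathcal P$ is stable if for all $Q^0,Q\in\mathcal P^e$ with associated martingales $Z^0_n=Z_n^{Q^0}$, $Z_n=Z_n^Q$, and every stopping time $\tau$, the martingale $L$ given by $L_n=Z^0_n$ for $n\le\tau$ and $L_n=Z^0_\tau Z_n/Z_\tau$ for $n\ge\tau$ defines an element of $\mathcal P$.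
   Formalization: In ''strictly comparable'', ''ξ1>ξ2 P0-a.s.'' is read as ξ1≥ξ2 P0-a.s. with P0(ξ1>ξ2)>0; read as strict inequality almost everywhere the condition is void and uniqueness fails (e.g. ρ(ξ)=ξ(a) on Ω={a,b}, P0 uniform, C=F). *)

(* Defs.v *)
From HB Require Import structures.
From mathcomp Require Export all_boot all_order all_algebra.
From mathcomp Require Export all_classical all_reals all_analysis.
From mathcomp Require Export measurable_realfun.

Set Implicit Arguments.
Unset Strict Implicit.
Unset Printing Implicit Defensive.

Export Order.TTheory GRing.Theory Num.Theory.
Export numFieldNormedType.Exports.

Local Open Scope classical_set_scope.
Local Open Scope ring_scope.
Local Open Scope charge_scope.

(* The space of bounded measurable real functions is [bounded_mfun T R]; for a
   sub-sigma-algebra C of T it is [bounded_mfun (g_sigma_algebraType C) R],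
   since [g_sigma_algebraType C] is the set T with the sigma-algebra generated
   by C. *)
Definition bounded_mfun d (T : measurableType d) (R : realType) :
    set (T -> R) :=
  [set f : T -> R | measurable_fun [set: T] f /\ [bounded f x | x in [set: T]]].

Arguments bounded_mfun {d} T R.

Definition bounded_nneg_mfun d (T : measurableType d) (R : realType) :
    set (T -> R) :=
  [set f : T -> R | bounded_mfun T R f /\ forall x, 0 <= f x].

Arguments bounded_nneg_mfun {d} T R.

Section SublinearOperator.
Context d (T : measurableType d) (R : realType).
Local Notation FF := (bounded_mfun T R).

(* A functional on bounded measurable functions is a total map on T -> R; every
   condition below only concerns its values on bounded measurable functions. *)
Implicit Type rho : (T -> R) -> R.

Definition sublinear_operator rho : Prop :=
  [/\ forall xi1 xi2, FF xi1 -> FF xi2 -> (forall x, xi2 x <= xi1 x) ->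
        rho xi2 <= rho xi1,
      forall c : R, rho (cst c) = c,
      forall xi1 xi2, FF xi1 -> FF xi2 ->
        rho (xi1 \+ xi2) <= rho xi1 + rho xi2 &
      forall (lambda : R) xi, 0 <= lambda -> FF xi ->
        rho (fun x => lambda * xi x) = lambda * rho xi].

Definition continuous_from_above rho : Prop :=
  forall xi : nat -> T -> R, (forall n, FF (xi n)) ->
    (forall x, nonincreasing_seq (fun n => xi n x)) ->
    (forall x, xi n x @[n --> \oo] --> (0 : R)) ->
    nonincreasing_seq (fun n => rho (xi n)) /\
    rho (xi n) @[n --> \oo] --> (0 : R).

Definition linear_functional (f : (T -> R) -> R) : Prop :=
  (forall xi1 xi2, FF xi1 -> FF xi2 -> f (xi1 \+ xi2) = f xi1 + f xi2) /\
  (forall (a : R) xi, FF xi -> f (fun x => a * xi x) = a * f xi).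

Definition dominated_functionals rho : set ((T -> R) -> R) :=
  [set f | linear_functional f /\ forall xi, FF xi -> f xi <= rho xi].

(* Functionals in the representation set of rho are identified with the
   probability measures of which they are the expectation. *)
Definition representation_set rho : set (probability T R) :=
  [set P | dominated_functionals rho (fun xi => fine 'E_P[xi]%E)].

Definition density (P0 P : probability T R) : T -> R :=
  fun x => fine (('d (charge_of_finite_measure P) '/d P0) x).

(* The topology sigma(L^1(P0), L^infty(P0)), on functions rather than on
   classes modulo almost sure equality: the initial topology for the maps
   f |-> E_P0[f g], g in L^infty(P0), packed into one map to a product space. *)
Definition L1_Linfty_pairing (P0 : probability T R)
    (f : LfunType P0 (lexx 1%E)) :
    {ptws (LfunType P0 (leey (1%E : \bar R))) -> R} :=
  fun g => \int[P0]_x (f x * g x).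

Definition sigma_L1_Linfty (P0 : probability T R) : topologicalType :=
  initial_topology (@L1_Linfty_pairing P0).

Arguments sigma_L1_Linfty : clear implicits.

Definition densities rho (P0 : probability T R) : set (sigma_L1_Linfty P0) :=
  [set f : LfunType P0 (lexx 1%E) |
    exists2 P, representation_set rho P & f = density P0 P %[ae P0]].

Arguments densities : clear implicits.

Definition reference_measure rho (P0 : probability T R) : Prop :=
  (forall P, representation_set rho P -> P `<< P0) /\
  compact (densities rho P0).

(* "xi1 > xi2 P0-a.s." is strict inequality in the order of P0-a.s. classes:
   xi1 >= xi2 almost surely and xi1 > xi2 with positive probability.  With
   xi1 > xi2 at almost every point the condition would be void, as it follows
   from P << P0 for P in the representation set. *)
Definition strictly_comparable rho (P0 : probability T R) : Prop :=
  forall xi1 xi2, FF xi1 -> FF xi2 ->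
    {ae P0, forall x, xi2 x <= xi1 x} ->
    (0 < P0 [set x | (xi2 x < xi1 x)%R])%E ->
    rho xi2 < rho xi1.

Definition is_sub_sigma_algebra (G : set (set T)) : Prop :=
  sigma_algebra [set: T] G /\ G `<=` measurable.

Definition is_cond_exp (P : probability T R) (G : set (set T))
    (X Y : T -> R) : Prop :=
  [/\ measurable_fun [set: g_sigma_algebraType G] Y,
      P.-integrable [set: T] (EFin \o Y) &
      forall A, G A ->
        (\int[P]_(x in A) (Y x)%:E = \int[P]_(x in A) (X x)%:E)%E].

Definition is_ess_sup (P0 : probability T R) (S : set (T -> R))
    (Y : T -> \bar R) : Prop :=
  [/\ measurable_fun [set: T] Y,
      forall X, S X -> {ae P0, forall x, ((X x)%:E <= Y x)%E} &
      forall Y' : T -> \bar R, measurable_fun [set: T] Y' ->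
        (forall X, S X -> {ae P0, forall x, ((X x)%:E <= Y' x)%E}) ->
        {ae P0, forall x, (Y x <= Y' x)%E}].

(* All versions of E_P[xi | C], for P in the representation set. *)
Definition cond_exps rho (C : set (set T)) (xi : T -> R) : set (T -> R) :=
  [set X | exists2 P, representation_set rho P & is_cond_exp P C xi X].

(* Time is numbered from 0: [Fn n] is the (n+1)-st sigma-algebra. *)
Definition filtration (Fn : nat -> set (set T)) : Prop :=
  [/\ forall n, is_sub_sigma_algebra (Fn n),
      forall m n, (m <= n)%N -> Fn m `<=` Fn n &
      <<s \bigcup_n Fn n >> = measurable].

(* The value None stands for infinity. *)
Definition stopping_time (Fn : nat -> set (set T)) (tau : T -> option nat) :
    Prop :=
  forall n, Fn n [set x | if tau x is Some k then (k <= n)%N else false].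

Definition equivalent_set rho (P0 : probability T R) : set (probability T R) :=
  [set Q | [/\ representation_set rho Q, Q `<< P0 & P0 `<< Q]].

Definition density_process (P0 : probability T R) (Fn : nat -> set (set T))
    (Q : probability T R) (Z : nat -> T -> R) : Prop :=
  forall n, is_cond_exp P0 (Fn n) (density P0 Q) (Z n).

Definition pasting (tau : T -> option nat) (Z0 Z : nat -> T -> R) :
    nat -> T -> R :=
  fun n x => if tau x is Some k then
               if (n <= k)%N then Z0 n x else Z0 k x * Z n x / Z k x
             else Z0 n x.

Definition stable rho (P0 : probability T R) (Fn : nat -> set (set T)) : Prop :=
  forall Q0 Q, equivalent_set rho P0 Q0 -> equivalent_set rho P0 Q ->
  forall Z0 Z, density_process P0 Fn Q0 Z0 -> density_process P0 Fn Q Z ->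
  forall tau, stopping_time Fn tau ->
  exists2 P, representation_set rho P &
    density_process P0 Fn P (pasting tau Z0 Z).

Definition objective rho (C : set (set T)) (xi eta : T -> R) : \bar R :=
  ereal_sup [set (rho (fun x => (xi x - eta x) ^+ 2
                                + eta' x * (xi x - eta x)))%:E
            | eta' in bounded_nneg_mfun (g_sigma_algebraType C) R].

Definition is_solution rho (C : set (set T)) (xi eta : T -> R) : Prop :=
  bounded_mfun (g_sigma_algebraType C) R eta /\
  objective rho C xi eta =
    ereal_inf [set objective rho C xi eta'
              | eta' in bounded_mfun (g_sigma_algebraType C) R].

End SublinearOperator.

(* Main.v *)
From HB Require Import structures.
Require Import Defs.
From mathcomp Require Import lra ring.

(** The inner supremum is a penalty that turns the problem into a constrained
    one.  Every P in the representation set gives the weight eta' the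
    expectation E_P [eta' (xi - eta)].  If eta >= E_P [xi | C] for all P, this
    is nonpositive for all eta' >= 0, so eta' = 0 is optimal and the objective
    is rho ((xi - eta) ^ 2) ([objective_dominating]).  If the inequality fails
    for some P on a set A in C, the weights t 1_A send the objective to
    infinity ([objective_not_dominating]).  Since the constraint
    eta >= E_P [xi | C] for all P means eta >= eta_ess almost surely
    ([dominates_ess_supP]), the problem is to minimize rho ((xi - eta) ^ 2)
    over the C-measurable eta >= eta_ess.

    Under each P, the conditional mean square error of a predictor increases
    with the predictor above E_P [xi | C], and eta_ess is the smallest feasible
    one.  The quantitative form, [rho_sq_gap], is
    rho ((xi - eta_ess) ^ 2) <= rho ((xi - eta) ^ 2 - (eta - eta_ess) ^ 2).
    Monotonicity of rho gives optimality of eta_ess; strict comparability,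
    applied to the right-hand side, gives a strict inequality unless
    eta = eta_ess almost surely, hence uniqueness.

    Three facts support this argument.  The supremum over P is attained at
    every bounded function ([representation_attained]): a Hahn-Banach
    functional touching rho is a probability by continuity from above
    ([supporting_linear_functional], [daniell]).  Strict comparability makes P0
    absolutely continuous with respect to every P
    ([strictly_comparable_dominates]), so almost sure statements pass between
    P0 and the P.  Finally conditional expectations exist and are uniformly
    bounded, and a bounded family of C-measurable functions has a bounded
    C-measurable essential supremum ([cond_exp_exists], [cond_exp_bounded],
    [ess_sup_exists]). *)

Set Implicit Arguments.
Unset Strict Implicit.
Unset Printing Implicit Defensive.

Local Open Scope classical_set_scope.
Local Open Scope ring_scope.
Local Open Scope charge_scope.

(** * Hahn-Banach: supporting linear functionals *)

Section HahnBanach.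
(* The subspace D will be that of bounded measurable functions, on which alone
   the values of a functional are meaningful. *)
Context (R : realType) (V : lmodType R) (D : set V).
Hypothesis DD : forall x y, D x -> D y -> D (x + y).
Hypothesis DZ : forall (a : R) x, D x -> D (a *: x).
Implicit Types (p q : V -> R) (x y z : V).

Definition sublinear_on p : Prop :=
  (forall x y, D x -> D y -> p (x + y) <= p x + p y) /\
  (forall (a : R) x, 0 <= a -> D x -> p (a *: x) = a * p x).

Definition below p q : Prop := forall x, D x -> p x <= q x.

Let DN x : D x -> D (- x).
Proof. by move=> Dx; rewrite -scaleN1r; exact: DZ. Qed.

Let DB x y : D x -> D y -> D (x - y).
Proof. by move=> Dx Dy; apply: DD => //; exact: DN. Qed.

Let sublinear0 p x : sublinear_on p -> D x -> p 0 = 0.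
Proof.
by case=> _ pZ Dx; rewrite -(scale0r x) pZ// mul0r.
Qed.

Let sublinear_lb p x y : sublinear_on p -> D x -> D y ->
  - p (- x) <= p (x + y) - p y.
Proof.
move=> [pD _] Dx Dy.
have := pD (x + y) (- x) (DD Dx Dy) (DN Dx).
rewrite addrAC subrr add0r; lra.
Qed.

(** Subhomogeneity upgrades to homogeneity by applying it to the inverse
    scalar. *)
Lemma sublinear_onP q :
  (forall x, D x -> q 0 = 0) ->
  (forall x y, D x -> D y -> q (x + y) <= q x + q y) ->
  (forall (a : R) x, 0 < a -> D x -> q (a *: x) <= a * q x) ->
  sublinear_on q.
Proof.
move=> q0 qD qZ; split => // a x; rewrite le_eqVlt => /predU1P[<- Dx|a0 Dx].
  by rewrite scale0r mul0r (q0 x).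
apply/eqP; rewrite eq_le qZ//= -ler_pdivlMl//.
have ai : 0 < a^-1 by rewrite invr_gt0.
have := qZ _ (a *: x) ai (DZ a Dx).
by rewrite scalerA mulVf ?gt_eqF// scale1r.
Qed.

(** Infima occur twice below: along a chain, for Zorn's lemma, and along a ray,
    for tilting.  To bound the infimum at a sum one may change the index: in a
    chain to the smaller of the two functionals, along a ray to the sum of the
    two parameters. *)
Lemma sublinear_on_inf (I : Type) (S : set I) (p_ : I -> V -> R) :
  S !=set0 ->
  (forall x, D x -> exists b, forall i, S i -> b <= p_ i x) ->
  (forall i x, S i -> D x -> p_ i 0 = 0) ->
  (forall i j x y, S i -> S j -> D x -> D y ->
    exists2 k, S k & p_ k (x + y) <= p_ i x + p_ j y) ->
  (forall i (a : R) x, S i -> 0 < a -> D x ->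
    exists2 k, S k & p_ k (a *: x) <= a * p_ i x) ->
  sublinear_on (fun x => inf [set p_ i x | i in S]).
Proof.
move=> [i0 Si0] lb S0 SD SZ.
have hlb x : D x -> has_lbound [set p_ i x | i in S].
  by move=> /lb[b bS]; exists b => _ [i Si <-]; exact: bS.
have infS x i : D x -> S i -> inf [set p_ i x | i in S] <= p_ i x.
  by move=> Dx Si; apply: ge_inf; [exact: hlb|exists i].
have ne x : [set p_ i x | i in S] !=set0 by exists (p_ i0 x), i0.
apply: sublinear_onP => [x Dx|x y Dx Dy|a x a0 Dx].
- rewrite (_ : [set _ | _ in _] = [set 0]) ?inf1//.
  apply/seteqP; split => [_ [i Si <-]|_ ->] /=; first exact: S0 Si Dx.
  by exists i0 => //; exact: S0 Si0 Dx.
- rewrite -lerBlDr; apply: lb_le_inf => // _ [i Si <-].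
  rewrite lerBlDr -lerBlDl; apply: lb_le_inf => // _ [j Sj <-].
  rewrite lerBlDl.
  have [k Sk] := SD i j x y Si Sj Dx Dy.
  by apply: le_trans; apply: infS => //; exact: DD.
- rewrite -ler_pdivrMl//; apply: lb_le_inf => // _ [i Si <-].
  rewrite ler_pdivrMl//; have [k Sk] := SZ i a x Si a0 Dx.
  by apply: le_trans; apply: infS => //; exact: DZ.
Qed.

(** Replacing p by x |-> inf_(t >= 0) (p (x + t x0) - t p x0) makes the
    functional additive in the direction x0: the value at - x0 becomes
    - p x0.  A minimal sublinear functional is unchanged by this operation,
    which is why it is linear. *)
Lemma tilted_sublinear p x0 : sublinear_on p -> D x0 ->
  exists q, [/\ sublinear_on q, below q p & q (- x0) <= - p x0].
Proof.
move=> sp Dx0; have [pD pZ] := sp.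
pose p_ (t : R) x := p (x + t *: x0) - t * p x0.
pose S : set R := [set t | 0 <= t].
have lb x t : D x -> S t -> - p (- x) <= p_ t x.
  by move=> Dx St; rewrite /p_ -pZ//; apply: sublinear_lb => //; exact: DZ.
have S0 : S !=set0 by exists 0; exact: lexx.
have ge x t : D x -> S t -> inf [set p_ i x | i in S] <= p_ t x.
  move=> Dx St; apply: ge_inf; last by exists t.
  by exists (- p (- x)) => _ [i Si <-]; exact: lb.
exists (fun x => inf [set p_ t x | t in S]); split.
- apply: sublinear_on_inf => //.
  + by move=> x Dx; exists (- p (- x)) => t; exact: lb.
  + by move=> t x St Dx; rewrite /p_ add0r pZ// subrr.
  + move=> s t x y Ss St Dx Dy; exists (s + t); first exact: addr_ge0.
    rewrite /p_ scalerDl addrACA.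
    have := pD (x + s *: x0) (y + t *: x0) (DD Dx (DZ s Dx0)) (DD Dy (DZ t Dx0)).
    lra.
  + move=> t a x St a0 Dx; exists (a * t); first exact: mulr_ge0 (ltW a0) St.
    rewrite /p_ -scalerA -scalerDr pZ ?(ltW a0)//; last first.
      by apply: DD => //; exact: DZ.
    by rewrite mulrBr mulrA.
- move=> x Dx; apply: le_trans (ge x 0 Dx (lexx 0)) _.
  by rewrite /p_ scale0r mul0r addr0 subr0.
- apply: le_trans (ge (- x0) 1 (DN Dx0) ler01) _.
  by rewrite /p_ scale1r addNr mul1r (sublinear0 sp Dx0) add0r.
Qed.

(** The order of the Zorn argument is a preorder only, since functionals are
    compared on D and not on V. *)
Lemma minimal_sublinear p0 : sublinear_on p0 ->
  exists p, [/\ sublinear_on p, below p p0 &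
    forall q, sublinear_on q -> below q p -> below p q].
Proof.
move=> s0; pose U := {p | sublinear_on p /\ below p p0}.
have b0 : sublinear_on p0 /\ below p0 p0 by split => // x _; exact: lexx.
pose r (p q : U) := `[< below (sval q) (sval p) >].
have [| | |[p [sp pp0]] pmin] := @ZL_preorder U (exist _ p0 b0) r.
- by move=> p; apply/asboolP => x _; exact: lexx.
- move=> p q s /asboolP qp /asboolP sq; apply/asboolP => x Dx.
  exact: le_trans (sq x Dx) (qp x Dx).
- move=> A Atot.
  have [A0|/set0P A0] := eqVneq A set0.
    by exists (exist _ p0 b0) => s; rewrite A0.
  have lb (s : U) x : D x -> A s -> - p0 (- x) <= sval s x.
    move=> Dx As; have [ss sp0] := svalP s.
    have := sublinear_lb ss Dx (DZ 0 Dx).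
    rewrite scale0r addr0 (sublinear0 ss Dx) subr0; apply: le_trans.
    by rewrite lerN2; apply: sp0; exact: DN.
  pose q x := inf [set sval s x | s in A].
  have ge x s : D x -> A s -> q x <= sval s x.
    move=> Dx As; apply: ge_inf; last by exists s.
    by exists (- p0 (- x)) => _ [i Ai <-]; exact: lb.
  have sq : sublinear_on q.
    apply: sublinear_on_inf => //.
    + by move=> x Dx; exists (- p0 (- x)) => s; exact: lb.
    + by move=> s x As Dx; exact: (sublinear0 (svalP s).1 Dx).
    + move=> s t x y As At Dx Dy; have [/asboolP st|/asboolP ts] := Atot s t As At.
      * exists t => //; apply: le_trans ((svalP t).1.1 x y Dx Dy) _.
        by rewrite lerD2r; exact: st.
      * exists s => //; apply: le_trans ((svalP s).1.1 x y Dx Dy) _.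
        by rewrite lerD2l; exact: ts.
    + move=> s a x As a0 Dx; exists s => //.
      by rewrite (svalP s).1.2 ?(ltW a0).
  have qp0 : below q p0.
    move=> x Dx; have [s As] := A0.
    by apply: le_trans (ge x s Dx As) _; exact: (svalP s).2.
  exists (exist _ q (conj sq qp0)) => s As; apply/asboolP => x Dx /=.
  exact: ge.
exists p; split => // q sq qp.
have qp0 : below q p0 by move=> x Dx; exact: le_trans (qp x Dx) (pp0 x Dx).
have rq : r (exist _ p (conj sp pp0)) (exist _ q (conj sq qp0)).
  exact/asboolP.
by have /asboolP := pmin _ rq.
Qed.

(** Tilting first in the direction x0 and then passing to a minimal functional
    gives a linear one that still satisfies f (- x0) <= - p0 x0, so that f
    touches p0 at x0. *)
Lemma supporting_linear_functional p0 x0 : sublinear_on p0 -> D x0 ->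
  exists f, [/\ forall x y, D x -> D y -> f (x + y) = f x + f y,
    forall (a : R) x, D x -> f (a *: x) = a * f x,
    below f p0 & f x0 = p0 x0].
Proof.
move=> s0 Dx0; have [q [sq qp0 qx0]] := tilted_sublinear s0 Dx0.
have [f [sf fq fmin]] := minimal_sublinear sq.
have [fD fZ] := sf.
have f0 : f 0 = 0 := sublinear0 sf Dx0.
have fN x : D x -> f (- x) = - f x.
  move=> Dx; have [g [sg gf gx]] := tilted_sublinear sf Dx.
  have := fmin _ sg gf (- x) (DN Dx).
  have := fD x (- x) Dx (DN Dx); rewrite subrr f0; lra.
exists f; split => //.
- move=> x y Dx Dy; apply/eqP; rewrite eq_le fD//=.
  have := fD _ _ (DN Dx) (DN Dy); rewrite -opprD !fN//; first lra.
  exact: DD.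
- move=> a x Dx; have [a0|a0] := leP 0 a; first exact: fZ.
  rewrite -(opprK a) scaleNr fN ?fZ ?mulNr//; [lra|exact: DZ].
- by move=> x Dx; exact: le_trans (fq x Dx) (qp0 x Dx).
- apply/eqP; rewrite eq_le (le_trans (fq _ Dx0) (qp0 _ Dx0))//=.
  have := fq _ (DN Dx0); rewrite fN//; lra.
Qed.

End HahnBanach.

(** * Bounded measurable functions *)

Section BoundedMeasurable.
Context d (T : measurableType d) (R : realType).
Local Notation FF := (bounded_mfun T R).
Implicit Types (f g : T -> R) (A : set T).

Lemma bounded_mfun_bound f : FF f -> exists2 M, 0 <= M & forall x, `|f x| <= M.
Proof.
move=> [_ /pinfty_ex_gt0[M M0 fM]]; exists M; first exact: ltW.
by move=> x; exact: fM.
Qed.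

Lemma bounded_mfunI f M : measurable_fun [set: T] f ->
  (forall x, `|f x| <= M) -> FF f.
Proof.
move=> mf fM; split => //; exists M; split; first exact: num_real.
by move=> N MN x _; exact: le_trans (fM x) (ltW MN).
Qed.

Lemma bounded_mfun_cst c : FF (cst c).
Proof. exact: (@bounded_mfunI _ `|c|). Qed.

Lemma bounded_mfunD f g : FF f -> FF g -> FF (f \+ g).
Proof.
move=> Ff Fg; have [M _ fM] := bounded_mfun_bound Ff.
have [N _ gN] := bounded_mfun_bound Fg.
apply: (@bounded_mfunI _ (M + N)); first exact: measurable_funD Ff.1 Fg.1.
by move=> x; apply: le_trans (ler_normD _ _) _; exact: lerD.
Qed.

Lemma bounded_mfunM f g : FF f -> FF g -> FF (f \* g).
Proof.
move=> Ff Fg; have [M M0 fM] := bounded_mfun_bound Ff.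
have [N N0 gN] := bounded_mfun_bound Fg.
apply: (@bounded_mfunI _ (M * N)); first exact: measurable_funM Ff.1 Fg.1.
by move=> x; rewrite normrM; exact: ler_pM.
Qed.

Lemma bounded_mfunZ a f : FF f -> FF (fun x => a * f x).
Proof. exact/bounded_mfunM/bounded_mfun_cst. Qed.

Lemma bounded_mfunB f g : FF f -> FF g -> FF (f \- g).
Proof.
move=> Ff Fg; rewrite (_ : f \- g = f \+ (fun x => -1 * g x)).
  exact/bounded_mfunD/bounded_mfunZ.
by apply/funext => x /=; rewrite mulN1r.
Qed.

Lemma bounded_mfun_max f g : FF f -> FF g -> FF (f \max g).
Proof.
move=> Ff Fg; have [M _ fM] := bounded_mfun_bound Ff.
have [N _ gN] := bounded_mfun_bound Fg.
apply: (@bounded_mfunI _ (M + N)); first exact: measurable_maxr Ff.1 Fg.1.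
by move=> x /=; case: (leP (f x) (g x)) => _; have := fM x; have := gN x;
  have := normr_ge0 (f x); have := normr_ge0 (g x); lra.
Qed.

Lemma bounded_mfun_indic A : measurable A -> FF \1_A.
Proof.
move=> mA; apply: (@bounded_mfunI _ 1); first exact: measurable_indic.
by move=> x; rewrite indicE; case: (_ \in _); rewrite /= ?normr0 ?normr1.
Qed.

Lemma measurable_set_lt f g : measurable_fun [set: T] f ->
  measurable_fun [set: T] g -> measurable [set x | f x < g x].
Proof.
move=> mf mg; rewrite (_ : [set _ | _] = ~` ([set: T] `&` [set x | g x <= f x])).
  by apply: measurableC; exact: measurable_fun_le.
by rewrite setTI; apply/seteqP; split => x /=; rewrite ltNge => /negP.
Qed.

Lemma measurable_fun_sub (C : set (set T)) f : C `<=` measurable ->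
  measurable_fun [set: g_sigma_algebraType C] f -> measurable_fun [set: T] f.
Proof.
move=> CT mf _ B mB; rewrite setTI.
have : <<s C >> `<=` (measurable : set (set T)).
  by apply: smallest_sub => //; exact: sigma_algebra_measurable.
by apply; rewrite -[_ @^-1` _]setTI; exact: mf.
Qed.

Lemma bounded_mfun_sub (C : set (set T)) f : C `<=` measurable ->
  bounded_mfun (g_sigma_algebraType C) R f -> FF f.
Proof. by move=> CT [mf bf]; split => //; exact: measurable_fun_sub mf. Qed.

(** Passage from indicators to nonnegative functions.  If 0 <= g <= c and A is
    the set where g >= c / 2, then g - (c / 2) 1_A lies between 0 and c / 2 and
    L g <= L (g - (c / 2) 1_A).  Iterating n times gives
    L g <= K c / 2 ^ n. *)
Lemma subadditive_le0 (L : (T -> R) -> R) (K : R) :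
  (forall f g, FF f -> FF g -> L (f \+ g) <= L f + L g) ->
  (forall a A, 0 <= a -> measurable A -> L (fun x => a * \1_A x) <= 0) ->
  (forall f b, FF f -> (forall x, 0 <= f x <= b) -> L f <= K * b) ->
  forall f, FF f -> (forall x, 0 <= f x) -> L f <= 0.
Proof.
move=> LD LI LK f Ff f0; have [b b0 fb] := bounded_mfun_bound Ff.
have halve n : forall g c, FF g -> 0 <= c -> (forall x, 0 <= g x <= c) ->
    L g <= K * (c * 2^-1 ^+ n).
  elim: n => [|n IH] g c Fg c0 gc; first by rewrite expr0 mulr1; exact: LK.
  pose A := [set x | c / 2 <= g x].
  have mA : measurable A.
    rewrite /A -[X in measurable X]setTI.
    by apply: measurable_fun_le => //; exact: Fg.1.
  pose s x := c / 2 * (\1_A x : R).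
  have Fs : FF s by apply: bounded_mfunZ; exact: bounded_mfun_indic.
  have -> : g = (g \- s) \+ s by apply/funext => x /=; rewrite subrK.
  apply: le_trans (LD _ _ (bounded_mfunB Fg Fs) Fs) _.
  have c2 : 0 <= c / 2 by rewrite divr_ge0.
  have := LI _ _ c2 mA; rewrite -/s => Ls.
  suff : L (g \- s) <= K * (c * 2^-1 ^+ n.+1) by lra.
  rewrite exprS [c * _]mulrA; apply: IH => //; first exact: bounded_mfunB.
  move=> x; rewrite /= /s indicE; have /andP[g0 gcx] := gc x.
  have [Ax|Ax] := boolP (x \in A); rewrite /= ?mulr1 ?mulr0.
    have : c / 2 <= g x := set_mem Ax; lra.
  have : ~ c / 2 <= g x by move=> /(@mem_set _ A); exact/negP.
  by move=> /negP; rewrite -ltNge; lra.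
have lim : K * (b * 2^-1 ^+ n) @[n --> \oo] --> K * (b * 0).
  apply: cvgMl_tmp; apply: cvgMl_tmp; apply: cvg_expr.
  by rewrite ger0_norm ?invr_ge0// invf_lt1 ?ltr1n.
rewrite !mulr0 in lim; apply: (cvgr_to_ge lim).
apply: nearW => n; apply: halve => // x.
by rewrite f0 (le_trans (ler_norm _) (fb x)).
Qed.
End BoundedMeasurable.

Arguments bounded_mfun_indic {d T R} [A].
Arguments bounded_mfun_cst {d T R}.

(** * Positive linear functionals and probability measures *)

Section LinearFunctionals.
Context d (T : measurableType d) (R : realType).
Local Notation FF := (bounded_mfun T R).
Implicit Types (f g : (T -> R) -> R) (X Y : T -> R).

Definition positive_functional f : Prop :=
  forall X, FF X -> (forall x, 0 <= X x) -> 0 <= f X.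

Lemma linear_functionalB f X Y : linear_functional f -> FF X -> FF Y ->
  f (X \- Y) = f X - f Y.
Proof.
move=> [fD fZ] FX FY; rewrite -mulN1r -fZ// -fD//; last exact: bounded_mfunZ.
by congr f; apply/funext => x /=; rewrite mulN1r.
Qed.

Lemma positive_le f X Y : linear_functional f -> positive_functional f ->
  FF X -> FF Y ->
  (forall x, X x <= Y x) -> f X <= f Y.
Proof.
move=> lf pf FX FY XY; rewrite -subr_ge0 -linear_functionalB//.
by apply: pf => [|x /=]; rewrite ?subr_ge0//; exact: bounded_mfunB.
Qed.

Lemma linear_functional_cst f c : linear_functional f ->
  f (cst c) = c * f (cst 1).
Proof.
move=> [_ fZ]; rewrite -fZ; last exact: bounded_mfun_cst.
by congr f; apply/funext => x /=; rewrite mulr1.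
Qed.

(** The difference of the two functionals vanishes on indicators, hence has
    both signs on nonnegative functions by [subadditive_le0]; adding a constant
    reduces the general case to that one. *)
Lemma positive_indic_eq f g : linear_functional f -> positive_functional f ->
  linear_functional g -> positive_functional g ->
  (forall A, measurable A -> f \1_A = g \1_A) -> forall X, FF X -> f X = g X.
Proof.
have half f' g' : linear_functional f' -> positive_functional f' ->
  linear_functional g' -> positive_functional g' ->
  (forall A, measurable A -> f' \1_A = g' \1_A) ->
  forall X, FF X -> (forall x, 0 <= X x) -> f' X <= g' X.
  move=> lf pf lg pg fg X FX X0; rewrite -subr_le0.
  apply: (@subadditive_le0 _ _ _ (fun X => f' X - g' X) (f' (cst 1))) X0 => //.
  - by move=> Y Z FY FZ; rewrite lf.1// lg.1//; lra.
  - move=> a A a0 mA; have FA := @bounded_mfun_indic _ _ R _ mA.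
    by rewrite lf.2// lg.2// fg// subrr.
  - move=> Y b FY Yb; apply: (@le_trans _ _ (f' Y)).
      by rewrite gerBl pg// => x; have /andP[] := Yb x.
    rewrite mulrC -linear_functional_cst//; apply: positive_le => //.
      exact: bounded_mfun_cst.
    by move=> x; have /andP[] := Yb x.
move=> lf pf lg pg fg X FX; have [M M0 XM] := bounded_mfun_bound FX.
have FM := @bounded_mfun_cst _ T R M.
have XM0 x : 0 <= (X \+ cst M) x.
  by have := XM x; rewrite ler_norml => /andP[+ _] /=; lra.
have eq1 : f (cst 1) = g (cst 1).
  have -> : cst 1 = \1_setT :> (T -> R) by rewrite indicT.
  exact: fg.
have : f (X \+ cst M) = g (X \+ cst M).
  apply/eqP; rewrite eq_le !half//; try exact: bounded_mfunD.
  by move=> A mA; rewrite fg.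
rewrite lf.1// lg.1// (linear_functional_cst M lf) (linear_functional_cst M lg).
by rewrite eq1 => /addIr.
Qed.

End LinearFunctionals.

Section Expectation.
Context d (T : measurableType d) (R : realType) (P : probability T R).
Local Notation FF := (bounded_mfun T R).
Implicit Types (X Y : T -> R).

Lemma bounded_mfun_integrable A X : measurable A -> FF X ->
  P.-integrable A (EFin \o X).
Proof.
move=> mA [mX bX]; apply: (@integrableS _ _ _ _ setT) => //.
apply: measurable_bounded_integrable => //.
by rewrite (le_lt_trans (probability_le1 _ _))// ltry.
Qed.

Lemma integral_mean A X : measurable A -> FF X ->
  (\int[P]_(x in A) (X x)%:E = (fine 'E_P[fun x => \1_A x * X x])%:E)%E.
Proof.
move=> mA FX; have FAX := bounded_mfunM (bounded_mfun_indic mA) FX.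
rewrite unlock fineK; last exact/integrable_fin_num/bounded_mfun_integrable.
rewrite integral_mkcond; apply: eq_integral => x _.
by rewrite patchE indicE; case: ifPn => /=; rewrite ?mul1r ?mul0r.
Qed.

Lemma expectationE X : FF X -> ('E_P[X] = (fine 'E_P[X])%:E)%E.
Proof.
move=> FX; rewrite fineK// unlock.
exact/integrable_fin_num/bounded_mfun_integrable.
Qed.

Lemma mean_linear : linear_functional (fun X => fine ('E_P[X])%E).
Proof.
split=> [X Y FX FY|a X FX].
  apply: EFin_inj; rewrite EFinD -!expectationE//; last exact: bounded_mfunD.
  by rewrite unlock integralD_EFin//; exact: bounded_mfun_integrable.
apply: EFin_inj; rewrite EFinM -!expectationE//; last exact: bounded_mfunZ.
rewrite unlock -integralZl//; exact: bounded_mfun_integrable.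
Qed.

Lemma mean_positive : positive_functional (fun X => fine ('E_P[X])%E).
Proof. by move=> X FX X0; rewrite fine_ge0// expectation_ge0. Qed.

Lemma mean_indic A : measurable A -> ((fine 'E_P[\1_A])%:E = P A)%E.
Proof.
move=> mA; rewrite -expectationE ?expectation_indic//.
exact: bounded_mfun_indic.
Qed.

End Expectation.

Section Daniell.
Context d (T : measurableType d) (R : realType).
Local Notation FF := (bounded_mfun T R).

Lemma indic_sum_cvg (F : nat -> set T) x : trivIset setT F ->
  \sum_(0 <= i < n) (\1_(F i) x : R) @[n --> \oo] --> (\1_(\bigcup_n F n) x : R).
Proof.
move=> tF; apply: cvg_near_cst.
have [/set_mem[k _ Fkx]|xF] := boolP (x \in \bigcup_n F n).
  exists k.+1 => // n /= kn.
  rewrite [RHS]indicE mem_set; last by exists k.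
  rewrite (bigD1_seq k) ?mem_index_iota ?iota_uniq//= indicE mem_set//.
  rewrite big1 ?addr0// => i ik; rewrite indicE memNset// => Fix.
  have := tF i k I I; rewrite -/((F i `&` F k !=set0) -> _) => /(_ _) e.
  by move: ik; rewrite e ?eqxx//; exists x.
exists 0%N => // n _; rewrite [RHS]indicE (negbTE xF) big1// => i _.
rewrite indicE memNset// => Fix; move/negP: xF; apply; rewrite inE.
by exists i.
Qed.

(** The measure is A |-> f 1_A.  If the F_n are disjoint with union U, then the
    functions 1_U - (1_(F_0) + ... + 1_(F_(n-1))) decrease to 0 pointwise, so
    continuity from above gives countable additivity. *)
Lemma daniell (f : (T -> R) -> R) :
  linear_functional f -> positive_functional f ->
  f (cst 1) = 1 -> continuous_from_above f ->
  exists P : probability T R, forall X, FF X -> fine ('E_P[X])%E = f X.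
Proof.
move=> lf pf f1 cf.
(* The absolute value only matters on non-measurable sets, where a measure is
   still required to be nonnegative. *)
pose mu (A : set T) : \bar R := `|f \1_A|%:E.
have f0 : f (cst 0) = 0 by rewrite linear_functional_cst// mul0r.
have fA A : measurable A -> 0 <= f \1_A.
  by move=> mA; apply: pf => [|x]; [exact: bounded_mfun_indic|rewrite indicE].
have mu0 : mu set0 = 0%E by rewrite /mu indic0 f0 normr0.
have mu_ge0 A : (0 <= mu A)%E by rewrite lee_fin.
have mu_add : semi_sigma_additive mu.
  move=> F mF tF mUF; pose U := \bigcup_n F n.
  pose g n x : R := \1_U x - \sum_(0 <= i < n) \1_(F i) x.
  have g0 n x : g n.+1 x = g n x - \1_(F n) x.
    by rewrite /g big_nat_recr//= opprD addrA.
  have Fg n : FF (g n).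
    elim: n => [|n IH].
      rewrite (_ : g 0%N = \1_U); first exact: bounded_mfun_indic.
      by apply/funext => x; rewrite /g big_nil subr0.
    rewrite (_ : g n.+1 = g n \- \1_(F n)); last by apply/funext => x; exact: g0.
    by apply: bounded_mfunB => //; exact: bounded_mfun_indic.
  have fg n : f (g n) = f \1_U - \sum_(0 <= i < n) f \1_(F i).
    elim: n => [|n IH].
      rewrite (_ : g 0%N = \1_U) ?big_nil ?subr0//.
      by apply/funext => x; rewrite /g big_nil subr0.
    rewrite (_ : g n.+1 = g n \- \1_(F n)); last by apply/funext => x; exact: g0.
    rewrite linear_functionalB//; last exact: bounded_mfun_indic.
    by rewrite IH big_nat_recr//= opprD addrA.
  have gdec x : nonincreasing_seq (fun n => g n x).
    by apply/nonincreasing_seqP => n; rewrite g0 gerBl indicE.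
  have g_cvg x : g n x @[n --> \oo] --> (0 : R).
    rewrite -(subrr (\1_U x : R)); apply: cvgB; first exact: cvg_cst.
    exact: indic_sum_cvg.
  have [_ fg0] := cf g Fg gdec g_cvg.
  have : \sum_(0 <= i < n) f \1_(F i) @[n --> \oo] --> f \1_U.
    rewrite -[X in _ --> X]subr0.
    rewrite (_ : (fun n => _) = fun n => f \1_U - f (g n)).
      by apply: cvgB => //; exact: cvg_cst.
    by apply/funext => n; rewrite fg subKr.
  have muE A : measurable A -> mu A = (f \1_A)%:E.
    by move=> mA; rewrite /mu ger0_norm// fA.
  rewrite muE// => sum_cvg.
  rewrite (_ : (fun n => _) = EFin \o (fun n => \sum_(0 <= i < n) f \1_(F i))).
    by apply: cvg_EFin; [exact: nearW|exact: sum_cvg].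
  apply/funext => n /=; rewrite -sumEFin; apply: eq_bigr => i _.
  exact: muE.
pose mu_isMeasure := @isMeasure.Build _ T R mu mu0 mu_ge0 mu_add.
pose m : {measure set T -> \bar R} :=
  HB.pack mu mu_isMeasure.
have mT : m setT = 1%E.
  rewrite /m /= /mu (_ : \1_setT = cst 1) ?f1 ?normr1//.
  by rewrite indicT.
pose P : probability T R := HB.pack mu mu_isMeasure
  (@Measure_isProbability.Build _ T R m mT).
exists P => X FX.
have lP := mean_linear P; have pP := mean_positive P.
apply: (positive_indic_eq lP pP lf pf) => // A mA.
apply: EFin_inj; rewrite mean_indic//.
by rewrite /= /mu ger0_norm// fA.
Qed.

End Daniell.

(** * The representation set of a sublinear operator *)

Section Representation.
Context d (T : measurableType d) (R : realType) (rho : (T -> R) -> R).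
Local Notation FF := (bounded_mfun T R).
Hypothesis rho_sublinear : sublinear_operator rho.

Lemma dominated_positive f : dominated_functionals rho f -> positive_functional f.
Proof.
have [rho_mono rho_cst _ _] := rho_sublinear.
move=> [lf f_rho] X FX X0; have FNX := bounded_mfunZ (-1) FX.
have := f_rho _ FNX; rewrite lf.2//.
have := rho_mono (cst 0) _ (bounded_mfun_cst 0) FNX.
rewrite rho_cst => /(_ _)/wrap[x /=|]; last lra.
by have := X0 x; lra.
Qed.

Lemma dominated_cst f c : dominated_functionals rho f -> f (cst c) = c.
Proof.
have [_ rho_cst _ _] := rho_sublinear.
move=> [lf f_rho]; rewrite linear_functional_cst//.
have := f_rho _ (bounded_mfun_cst 1); have := f_rho _ (bounded_mfun_cst (-1)).
rewrite !rho_cst (linear_functional_cst (-1) lf) => f1 f2.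
suff -> : f (cst 1) = 1 by rewrite mulr1.
lra.
Qed.

Hypothesis rho_cont : continuous_from_above rho.

(** The supremum representing rho is a maximum: the Hahn-Banach functional that
    touches rho at X inherits continuity from above from rho, so it is an
    expectation. *)
Lemma representation_attained X : FF X ->
  exists2 P, representation_set rho P & fine ('E_P[X])%E = rho X.
Proof.
move=> FX; have [rho_mono rho_cst rhoD rhoZ] := rho_sublinear.
(* R^o is R as a module over itself, which makes T -> R^o a module over R. *)
have srho : @sublinear_on R (T -> R^o) FF rho by split.
have DD (x y : T -> R^o) : FF x -> FF y -> FF (x + y) by exact: bounded_mfunD.
have DZ (a : R) (x : T -> R^o) : FF x -> FF (a *: x) by exact: bounded_mfunZ.
have [f [fD fZ f_rho fX]] := supporting_linear_functional DD DZ srho FX.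
have lf : linear_functional f by split.
have df : dominated_functionals rho f by split.
have pf := dominated_positive df.
have cf : continuous_from_above f.
  move=> xi Fxi xi_dec xi_cvg; have [_ rho_cvg] := rho_cont Fxi xi_dec xi_cvg.
  split.
    by apply/nonincreasing_seqP => n; apply: positive_le => // x; exact: xi_dec.
  apply: squeeze_cvgr (cvg_cst 0) rho_cvg; apply: nearW => n.
  rewrite f_rho ?andbT//; apply: pf => // x.
  rewrite -(cvg_lim _ (xi_cvg x))//.
  by apply: nonincreasing_cvgn_ge => //; exact: cvgP (xi_cvg x).
have [P EP] := daniell lf pf (dominated_cst 1 df) cf.
exists P; last by rewrite EP.
by split; [exact: mean_linear|move=> Y FY; rewrite EP//; exact: f_rho].
Qed.

(** Compare 0 with - 1_A: if P0 A > 0 then rho (- 1_A) < rho 0 = 0, and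
    - P A <= rho (- 1_A) for every P in the representation set. *)
Lemma strictly_comparable_dominates (P0 P : probability T R) :
  strictly_comparable rho P0 -> representation_set rho P -> P0 `<< P.
Proof.
move=> sc rP; apply/null_content_dominatesP => A mA PA0.
have [_ rho_cst _ _] := rho_sublinear.
apply/eqP/negPn/negP => P0A.
have FA := bounded_mfun_indic (R := R) mA.
have := sc (cst 0) (fun x => -1 * \1_A x) (bounded_mfun_cst 0)
  (bounded_mfunZ _ FA).
rewrite rho_cst => /(_ _ _)/wrap[].
- by apply: aeW => x /=; rewrite indicE; case: (_ \in _); rewrite /=; lra.
- rewrite (_ : [set _ | _] = A); first by rewrite lt0e P0A measure_ge0.
  apply/seteqP; split => x /=; rewrite indicE.
    by case: (boolP (x \in A)) => [/set_mem//|] /=; rewrite mulr0 ltxx.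
  by move=> /mem_set -> /=; lra.
- have := rP.2 _ (bounded_mfunZ (-1) FA); rewrite (mean_linear P).2//.
  have : fine ('E_P[\1_A])%E = 0 by apply: EFin_inj; rewrite mean_indic.
  by move=> ->; lra.
Qed.

End Representation.

Lemma dominates_ae d (T : measurableType d) (R : realType)
    (P Q : probability T R) (S : T -> Prop) :
  P `<< Q -> {ae Q, forall x, S x} -> {ae P, forall x, S x}.
Proof.
move=> /null_content_dominatesP PQ [A [mA QA SA]].
by exists A; split => //; exact: PQ.
Qed.

(** * Conditional expectations *)

Section ConditionalExpectation.
Context d (T : measurableType d) (R : realType) (P : probability T R).
Context (C : set (set T)) (subC : is_sub_sigma_algebra C).
Local Notation FF := (bounded_mfun T R).

(** On the set where W < U the integral of U - W > 0 is nonpositive, so that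
    set is null.  Only this set is tested, which is what makes the lemma
    applicable when the integrals are known on a sub-sigma-algebra. *)
Lemma ae_le_integral (U W : T -> R) : measurable_fun [set: T] U ->
  measurable_fun [set: T] W ->
  P.-integrable [set: T] (EFin \o U) -> P.-integrable [set: T] (EFin \o W) ->
  (\int[P]_(x in [set x | (W x < U x)%R]) (U x)%:E <=
   \int[P]_(x in [set x | (W x < U x)%R]) (W x)%:E)%E ->
  {ae P, forall x, U x <= W x}.
Proof.
move=> mU mW iU iW; set A := [set x | _] => UW.
have mA : measurable A by exact: measurable_set_lt.
have iUA : P.-integrable A (EFin \o U) by exact: integrableS iU.
have iWA : P.-integrable A (EFin \o W) by exact: integrableS iW.
have mUW : measurable_fun A (EFin \o (U \- W)).
  by apply/measurable_EFinP/measurable_funTS/measurable_funB.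
have /(ae_eq_integral_abs P mA mUW) :
  (\int[P]_(x in A) `|(EFin \o (U \- W)%R) x| = 0)%E.
  rewrite (eq_integral ((EFin \o U) \- (EFin \o W))%E); last first.
    move=> x /set_mem; rewrite /A/= => Ax.
    by rewrite ger0_norm// subr_ge0 ltW.
  rewrite integralB//; apply/eqP; rewrite eq_le; apply/andP; split.
    by rewrite sube_le0.
  rewrite -integralB//; apply: integral_ge0 => x Ax.
  by rewrite -EFinB lee_fin subr_ge0 ltW.
apply: filterS => x UW0; rewrite leNgt; apply/negP => Ax.
have [/eqP] := UW0 Ax; rewrite subr_eq0 => /eqP e.
by move: Ax; rewrite e ltxx.
Qed.

Lemma sub_sigma_algebraE : C.-sigma.-measurable = C.
Proof. by apply: measurable_g_measurableTypeE; exact: subC.1. Qed.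

(** The restrictions to C of P and of the charge A |-> \int_A xi dP are their
    images under the identity map from T to T equipped with C; the conditional
    expectation is the Radon-Nikodym derivative of the second with respect to
    the first. *)
Lemma cond_exp_exists xi : FF xi -> exists X, is_cond_exp P C xi X.
Proof.
move=> Fxi; pose TC := g_sigma_algebraType C.
have mid : measurable_fun [set: T] (id : T -> TC).
  by move=> _ B; rewrite sub_sigma_algebraE setTI => /subC.2.
have ixi := bounded_mfun_integrable P (@measurableT _ T) Fxi.
(* The charge structure of an image depends on the measurability proof mid,
   which unification cannot supply; hence the explicit instance. *)
pose nu : {charge set TC -> \bar R} :=
  measure_function_pushforward__canonical__charge_Charge (induced_charge ixi) mid.
pose idm : {mfun T >-> TC} := mfun_Sub (mem_set mid).
pose PC : probability TC R := distribution P idm.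
have nuPC : nu `<< PC.
  apply/null_content_dominatesP => A mA PA0.
  have mA' : measurable (A : set T) by apply: subC.2; rewrite -sub_sigma_algebraE.
  rewrite /nu /= /pushforward /induced_charge preimage_id.
  apply: null_set_integral => //.
  exact/measurable_EFinP/measurable_funTS/Fxi.1.
pose X x := fine (('d nu '/d PC) x).
have XE : EFin \o X = 'd nu '/d PC.
  by apply/funext => x; rewrite /= fineK//; exact: Radon_Nikodym_fin_num.
have mX : measurable_fun [set: TC] X.
  apply/measurable_EFinP; rewrite XE.
  exact: measurable_int (Radon_Nikodym_integrable nuPC).
have iX : P.-integrable [set: T] (EFin \o X).
  have := Radon_Nikodym_integrable nuPC; rewrite -XE => /integrableP[mEX iX].
  apply/integrableP; split.
    by apply/measurable_EFinP/(measurable_fun_sub subC.2).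
  move: iX; rewrite ge0_integral_pushforward//.
  exact: measurableT_comp.
exists X; split => // A CA.
have mA : measurable (A : set TC) by rewrite sub_sigma_algebraE.
have := Radon_Nikodym_integral nuPC mA.
rewrite -XE integral_pushforward//=; first exact/measurable_EFinP.
apply: integrableS iX => //.
by rewrite preimage_id; apply: subC.2.
Qed.

End ConditionalExpectation.

(** * Existence of a measurable essential supremum *)

Section EssentialSupremum.
Context d (T : measurableType d) (R : realType) (P0 : probability T R).
Context (C : set (set T)) (subC : is_sub_sigma_algebra C).
Local Notation TC := (g_sigma_algebraType C).
Local Notation FF := (bounded_mfun T R).

(** Let D be the set of C-measurable functions with values in [- M, M] that lie
    almost surely below every upper bound of S.  It is closed under countable
    suprema, so it contains some Y that maximises the expectation under P0.
    For X in S the maximum of Y and of X truncated to [- M, M] is again in D,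
    and by maximality it cannot exceed Y on a set of positive measure. *)
Lemma ess_sup_exists (S : set (T -> R)) (M : R) :
  S !=set0 ->
  (forall X, S X -> measurable_fun [set: TC] X) ->
  (forall X, S X -> {ae P0, forall x, `|X x| <= M}) ->
  exists2 Y, bounded_mfun TC R Y & is_ess_sup P0 S (EFin \o Y).
Proof.
move=> [X0 SX0] mS SM.
pose upper (Y' : T -> \bar R) := measurable_fun [set: T] Y' /\
  forall X, S X -> {ae P0, forall x, ((X x)%:E <= Y' x)%E}.
pose D : set (T -> R) := [set Y : T -> R |
  [/\ measurable_fun [set: TC] Y, forall x, `|Y x| <= M &
    forall Y', upper Y' -> {ae P0, forall x, ((Y x)%:E <= Y' x)%E}]].
have DFC Y : D Y -> bounded_mfun TC R Y.
  by case=> mY YM _; exact: (@bounded_mfunI _ TC R Y M).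
have DF Y : D Y -> FF Y by move=> /DFC; exact/bounded_mfun_sub/subC.2.
pose clip (X : T -> R) x := Num.max (- M) (Num.min M (X x)).
have M0 : 0 <= M.
  have [A [mA A0 XA]] := SM _ SX0.
  rewrite leNgt; apply/negP => M0; have : P0 setT = 0%E.
    rewrite -A0; congr (P0 _); apply/seteqP; split => // x _; apply: XA => /=.
    by apply/negP; rewrite -ltNge (lt_le_trans M0).
  by rewrite probability_setT => /eqP; rewrite onee_eq0.
have clipE (X : T -> R) x : `|X x| <= M -> clip X x = X x.
  rewrite /clip ler_norml => /andP[? ?].
  by rewrite (min_idPr _)// (max_idPr _).
have Dclip X : S X -> D (clip X).
  move=> SX; split.
  - apply: measurable_maxr; first exact: measurable_cst.
    by apply: measurable_minr; [exact: measurable_cst|exact: mS].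
  - move=> x; rewrite /clip ler_norml le_max lexx/= ge_max ge_min lexx/= andbT.
    lra.
  - move=> Y' [_ /(_ _ SX)]; apply: filterS2 (SM _ SX) => x XM.
    by rewrite clipE.
have Dmax Y Z : D Y -> D Z -> D (Y \max Z).
  move=> [mY YM uY] [mZ ZM uZ]; split; first exact: measurable_maxr.
  - by move=> x /=; case: (leP (Y x) (Z x)).
  - move=> Y' uY'; apply: filterS2 (uY _ uY') (uZ _ uY') => x /=.
    by case: (leP (Y x) (Z x)).
have Dsup (Y_ : nat -> T -> R) : (forall n, D (Y_ n)) ->
    exists2 Y, D Y & forall n x, Y_ n x <= Y x.
  move=> DY.
  have ub x : has_ubound (range (Y_ ^~ x)).
    exists M => _ [n _ <-]; have [_ /(_ x)+ _] := DY n.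
    by rewrite ler_norml => /andP[].
  pose Y x := sup (range (Y_ ^~ x)).
  have leY n x : Y_ n x <= Y x by apply: ub_le_sup => //; exists n.
  exists Y => //; split.
  - rewrite (_ : Y = fun x => sups (Y_ ^~ x) 0%N).
      by apply: measurable_fun_sups => // n; have [] := DY n.
    apply/funext => x; rewrite /Y /sups /sdrop; congr sup.
    by apply/seteqP; split => _ [n _ <-]; exists n.
  - move=> x; rewrite ler_norml; have [_ /(_ x)+ _] := DY 0%N.
    rewrite ler_norml => /andP[Y0M _]; rewrite (le_trans Y0M (leY _ _))/=.
    apply: ge_sup; first by exists (Y_ 0%N x), 0%N.
    move=> _ [n _ <-]; have [_ /(_ x)+ _] := DY n.
    by rewrite ler_norml => /andP[].
  - move=> Y' uY'.
    have /ae_foralln : forall n, {ae P0, forall x, ((Y_ n x)%:E <= Y' x)%E}.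
      by move=> n; have [_ _ /(_ _ uY')] := DY n.
    apply: filterS => x le; move: (le 0%N); case: (Y' x) le => [r| |] // le _.
      rewrite lee_fin; apply: ge_sup; first by exists (Y_ 0%N x), 0%N.
      by move=> _ [n _ <-]; rewrite -lee_fin.
    by rewrite leey.
pose mean (Y : T -> R) := fine ('E_P0[Y])%E.
have lm : linear_functional mean := mean_linear P0.
have pm : positive_functional mean := @mean_positive _ _ _ P0.
pose E : set R := [set mean Y | Y in D].
have E0 : E !=set0 by exists (mean (clip X0)), (clip X0) => //; exact: Dclip.
have Eub : has_ubound E.
  exists (mean (cst M)) => _ [Y DY <-]; apply: positive_le => //.
  - exact: DF.
  - exact: bounded_mfun_cst.
  - by move=> x; have [_ /(_ x)+ _] := DY; rewrite ler_norml => /andP[].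
have /choice[Y_ Y_P] n : exists Y, D Y /\ sup E - n.+1%:R^-1 < mean Y.
  have n0 : 0 < n.+1%:R^-1 :> R by [].
  by have [_ [Y DY <-] ltY] := sup_adherent n0 (conj E0 Eub); exists Y.
have [Y DY leY] := Dsup Y_ (fun n => (Y_P n).1).
have supY : sup E <= mean Y.
  rewrite leNgt; apply/negP => /ltr_add_invr[n ltn].
  have := (Y_P n).2; rewrite ltrBlDr => lt1.
  suff leYn : mean (Y_ n) <= mean Y.
    by have := lt_le_trans lt1 (lerD leYn (lexx _)); rewrite ltNge (ltW ltn).
  by apply: positive_le => //; apply: DF => //; exact: (Y_P n).1.
exists Y; first exact: DFC.
split.
- by apply/measurable_EFinP; exact: (DF _ DY).1.
- move=> X SX; pose Z := Y \max clip X.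
  have DZ : D Z by apply: Dmax => //; exact: Dclip.
  have YZ x : Y x <= Z x by rewrite /Z/= le_max lexx.
  have ZY : mean Z <= mean Y.
    by apply: le_trans supY; apply: ub_le_sup => //; exists Z.
  have FZ := DF _ DZ; have FY := DF _ DY.
  have : {ae P0, forall x, Z x <= Y x}.
    apply: ae_le_integral; [exact: FZ.1|exact: FY.1| | |].
    - exact: bounded_mfun_integrable.
    - exact: bounded_mfun_integrable.
    - set A := [set x | _].
      have mA : measurable A := measurable_set_lt FY.1 FZ.1.
      have FA := bounded_mfun_indic (R := R) mA.
      rewrite !integral_mean// lee_fin.
      suff : mean (\1_A \* Z) - mean (\1_A \* Y) <= 0 by rewrite subr_le0.
      rewrite -(linear_functionalB lm); [|exact: bounded_mfunM..].
      rewrite (_ : _ \- _ = Z \- Y) ?(linear_functionalB lm) ?subr_le0//.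
      apply/funext => x /=; rewrite indicE.
      have [Ax|Ax] := boolP (x \in A); first by rewrite !mul1r.
      have : ~ Y x < Z x by move=> /(@mem_set _ A); exact/negP.
      move=> /negP; rewrite -leNgt => ZYx; rewrite !mul0r subrr.
      by apply/esym/eqP; rewrite subr_eq0 eq_le ZYx YZ.
  apply: filterS2 (SM _ SX) => x XM; rewrite lee_fin.
  by rewrite /Z /= clipE// ge_max => /andP[].
- by move=> Y' mY' uY'; have [_ _] := DY; apply.
Qed.

End EssentialSupremum.

(** * Comparison with conditional expectations *)

Section CondExpOrder.
Context d (T : measurableType d) (R : realType) (P : probability T R).
Context (C : set (set T)) (subC : is_sub_sigma_algebra C).
Local Notation TC := (g_sigma_algebraType C).
Local Notation FF := (bounded_mfun T R).
Local Notation FC := (bounded_mfun TC R).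

Let FCF (W : T -> R) : FC W -> FF W.
Proof. exact/bounded_mfun_sub/subC.2. Qed.

Lemma measurable_set_lt_sub (U W : T -> R) : measurable_fun [set: TC] U ->
  measurable_fun [set: TC] W -> C [set x | U x < W x].
Proof.
by move=> mU mW; rewrite -[C](sub_sigma_algebraE subC); exact: measurable_set_lt.
Qed.

Lemma mean_ae_eq (X Y : T -> R) : FF X -> FF Y -> {ae P, forall x, X x = Y x} ->
  fine ('E_P[X])%E = fine ('E_P[Y])%E.
Proof.
move=> FX FY XY; rewrite unlock; congr fine.
apply: ae_eq_integral => //;
  [exact/measurable_EFinP/FX.1|exact/measurable_EFinP/FY.1|].
by apply: filterS XY => x -> _.
Qed.

Lemma cond_exp_le (xi X W : T -> R) : is_cond_exp P C xi X -> FC W ->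
  (forall A, C A ->
    (\int[P]_(x in A) (xi x)%:E <= \int[P]_(x in A) (W x)%:E)%E) ->
  {ae P, forall x, X x <= W x}.
Proof.
move=> [mX iX XE] FW xiW; have FW' := FCF FW.
apply: ae_le_integral => //.
- exact: measurable_fun_sub subC.2 mX.
- exact: FW'.1.
- exact: bounded_mfun_integrable.
- have CA := measurable_set_lt_sub FW.1 mX.
  by rewrite XE//; exact: xiW.
Qed.

Lemma cond_exp_ge (xi X W : T -> R) : is_cond_exp P C xi X -> FC W ->
  (forall A, C A ->
    (\int[P]_(x in A) (W x)%:E <= \int[P]_(x in A) (xi x)%:E)%E) ->
  {ae P, forall x, W x <= X x}.
Proof.
move=> [mX iX XE] FW xiW; have FW' := FCF FW.
apply: ae_le_integral => //.
- exact: FW'.1.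
- exact: measurable_fun_sub subC.2 mX.
- exact: bounded_mfun_integrable.
- have CA := measurable_set_lt_sub mX FW.1.
  by rewrite XE//; exact: xiW.
Qed.

Lemma integral_le_mean (X Y : T -> R) A : FF X -> FF Y -> measurable A ->
  (\int[P]_(x in A) (X x)%:E <= \int[P]_(x in A) (Y x)%:E)%E =
  (fine ('E_P[(\1_A \* (X \- Y))%R])%E <= 0).
Proof.
move=> FX FY mA; have FA := bounded_mfun_indic (R := R) mA.
rewrite !integral_mean// lee_fin -subr_le0.
have FAX := bounded_mfunM FA FX; have FAY := bounded_mfunM FA FY.
have /= <- := linear_functionalB (mean_linear P) FAX FAY.
by congr (fine ('E_P[ _ ])%E <= 0); apply/funext => x /=; rewrite mulrBr.
Qed.

Lemma cond_exp_bounded (xi X : T -> R) M : FF xi -> (forall x, `|xi x| <= M) ->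
  is_cond_exp P C xi X -> {ae P, forall x, `|X x| <= M}.
Proof.
move=> Fxi xiM ceX; have le A : C A -> measurable A by exact: subC.2.
have bd c : FF (cst c) by exact: bounded_mfun_cst.
have le1 : {ae P, forall x, X x <= M}.
  apply: (@cond_exp_le _ _ (cst M)) ceX _ _ => [|A /le mA].
    exact: bounded_mfun_cst.
  apply: le_integral => //; try exact: bounded_mfun_integrable.
  by move=> x _; rewrite lee_fin; have := xiM x; rewrite ler_norml => /andP[].
have le2 : {ae P, forall x, - M <= X x}.
  apply: (@cond_exp_ge _ _ (cst (- M))) ceX _ _ => [|A /le mA].
    exact: bounded_mfun_cst.
  apply: le_integral => //; try exact: bounded_mfun_integrable.
  by move=> x _; rewrite lee_fin; have := xiM x; rewrite ler_norml => /andP[].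
by apply: filterS2 le1 le2 => x; rewrite ler_norml => -> ->.
Qed.

(** The right-hand side no longer mentions a version of the conditional
    expectation: the almost sure comparison becomes a condition on the linear
    functional E_P alone, and that is the form in which the penalty term of the
    optimization problem detects it. *)
Lemma cond_exp_leP (xi X eta : T -> R) : FF xi -> FC eta ->
  is_cond_exp P C xi X ->
  {ae P, forall x, X x <= eta x} <->
  forall A, C A -> fine ('E_P[(\1_A \* (xi \- eta))%R])%E <= 0.
Proof.
move=> Fxi FCeta ceX; have Feta := FCF FCeta.
split=> [Xeta A CA|xieta]; last first.
  apply: cond_exp_le ceX FCeta _ => A CA.
  by rewrite integral_le_mean//; [exact: xieta|exact: subC.2].
have mA := subC.2 _ CA.
have [mX iX XE] := ceX; rewrite -integral_le_mean// -XE//.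
have mX' := measurable_fun_sub subC.2 mX.
have iXA : P.-integrable A (EFin \o X) by exact: integrableS iX.
have ietaA := bounded_mfun_integrable P mA Feta.
have iB : P.-integrable A ((EFin \o eta) \- (EFin \o X))%E by exact: integrableB.
rewrite -sube_ge0 ?integrable_fin_num// -integralB//.
rewrite (ae_eq_integral (fun x => `|((EFin \o eta) \- (EFin \o X))%E x|%E))//.
- by apply: integral_ge0.
- exact: measurable_int iB.
- by apply: measurableT_comp => //; exact: measurable_int iB.
- apply: filterS Xeta => x Xeta _ /=.
  by rewrite ger0_norm ?subr_ge0.
Qed.

End CondExpOrder.

(** * The optimization problem *)

Section Objective.
Context d (T : measurableType d) (R : realType) (rho : (T -> R) -> R).
Context (C : set (set T)) (subC : is_sub_sigma_algebra C).
Local Notation TC := (g_sigma_algebraType C).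
Local Notation FF := (bounded_mfun T R).
Local Notation FC := (bounded_mfun TC R).
Hypothesis rho_sublinear : sublinear_operator rho.
Hypothesis rho_cont : continuous_from_above rho.
Implicit Types xi e eta eta_ess : T -> R.

Let FCF (W : T -> R) : FC W -> FF W.
Proof. exact/bounded_mfun_sub/subC.2. Qed.

(** An inequality that holds on the sets of C holds against all bounded
    nonnegative C-measurable weights, by [subadditive_le0] on the measurable
    space T equipped with C. *)
Lemma nonneg_multiplier (f : (T -> R) -> R) (Y g : T -> R) :
  linear_functional f -> positive_functional f -> FF Y ->
  (forall A, C A -> f (\1_A \* Y) <= 0) ->
  FC g -> (forall x, 0 <= g x) -> f (g \* Y) <= 0.
Proof.
move=> lf pf FY fAY FCg g0; have [M M0 YM] := bounded_mfun_bound FY.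
have FgY (h : T -> R) : FC h -> FF (h \* Y).
  by move=> FCh; exact: bounded_mfunM (FCF FCh) FY.
apply: (@subadditive_le0 _ TC R (fun g => f (g \* Y)) (M * f (cst 1))) g0 => //.
- move=> g1 g2 Fg1 Fg2.
  rewrite (_ : (g1 \+ g2) \* Y = (g1 \* Y) \+ (g2 \* Y)); last first.
    by apply/funext => x /=; rewrite mulrDl.
  by rewrite lf.1//; exact: FgY.
- move=> a A a0 mA.
  have CA : C A by rewrite -[C](sub_sigma_algebraE subC).
  rewrite (_ : _ \* Y = fun x => a * (\1_A \* Y) x); last first.
    by apply/funext => x /=; rewrite mulrA.
  rewrite lf.2; first by rewrite mulr_ge0_le0// fAY.
  exact: (FgY _ (bounded_mfun_indic mA)).
- move=> g1 b Fg1 g1b.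
  rewrite mulrAC -(linear_functional_cst _ lf); apply: (positive_le lf pf).
  + exact: FgY.
  + exact: bounded_mfun_cst.
  + move=> x /=; have /andP[g10 g1b'] := g1b x.
    apply: le_trans (ler_norm _) _; rewrite normrM (ger0_norm g10) mulrC.
    exact: ler_pM.
Qed.

(** A version-free form of eta >= E_P [xi | C] for all P in the representation
    set; see [cond_exp_leP]. *)
Definition dominates_cond_exps (xi eta : T -> R) : Prop :=
  forall P : probability T R, representation_set rho P ->
    forall A, C A -> fine ('E_P[(\1_A \* (xi \- eta))%R])%E <= 0.

Let sq (xi eta : T -> R) : T -> R := fun x => (xi x - eta x) ^+ 2.

Let Fsq xi eta : FF xi -> FF eta -> FF (sq xi eta).
Proof.
move=> Fxi Feta; have FB := bounded_mfunB Fxi Feta.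
rewrite (_ : sq _ _ = (xi \- eta) \* (xi \- eta)); first exact: bounded_mfunM.
by apply/funext => x; rewrite /sq expr2.
Qed.

(** By [nonneg_multiplier] the penalty has nonpositive expectation under every
    P, so the weight 0 is optimal in the inner supremum. *)
Lemma objective_dominating xi eta : FF xi -> FC eta ->
  dominates_cond_exps xi eta ->
  objective rho C xi eta = (rho (fun x => (xi x - eta x) ^+ 2))%:E.
Proof.
move=> Fxi FCeta dom; have Feta := FCF FCeta.
have FB := bounded_mfunB Fxi Feta; have FS := Fsq Fxi Feta.
apply/eqP; rewrite eq_le; apply/andP; split.
  apply: ge_ereal_sup => _ [g [FCg g0] <-]; rewrite lee_fin.
  have FgB := bounded_mfunM (FCF FCg) FB.
  have [P rP <-] :=
    representation_attained rho_sublinear rho_cont (bounded_mfunD FS FgB).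
  rewrite (mean_linear P).1//.
  have := rP.2 _ FS.
  have := nonneg_multiplier (mean_linear P) (@mean_positive _ _ _ P) FB
    (dom P rP) FCg g0.
  rewrite /sq /=; lra.
apply: ereal_sup_ubound; exists (cst 0).
  by split => [|x]; [exact: bounded_mfun_cst|exact: lexx].
by congr EFin; congr rho; apply/funext => x /=; rewrite mul0r addr0.
Qed.

(** If E_P [1_A (xi - eta)] > 0, then the weights t 1_A with t large make the
    expectation under P, hence rho, arbitrarily large. *)
Lemma objective_not_dominating xi eta : FF xi -> FC eta ->
  ~ dominates_cond_exps xi eta -> objective rho C xi eta = +oo%E.
Proof.
move=> Fxi FCeta; have Feta := FCF FCeta.
have FB := bounded_mfunB Fxi Feta; have FS := Fsq Fxi Feta.
rewrite /dominates_cond_exps => /existsNP[P] /not_implyP[rP] /existsNP[A].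
move=> /not_implyP[CA] /negP; rewrite -ltNge => c0.
set c := fine _ in c0.
have lP := mean_linear P.
have FA := bounded_mfun_indic (R := R) (subC.2 _ CA).
have FCA : FC \1_A.
  by apply: bounded_mfun_indic; rewrite sub_sigma_algebraE.
apply/eqP; rewrite -leye_eq leye_eq; apply/eqP/eqyP => r r0.
have t0 : 0 <= r / c by rewrite divr_ge0 // ltW.
apply: (@le_trans _ _ (rho (fun x => (xi x - eta x) ^+ 2 +
    (r / c * \1_A x) * (xi x - eta x)))%:E).
  rewrite lee_fin.
  have FAB := bounded_mfunM FA FB.
  have F2 := bounded_mfunZ (r / c) FAB.
  rewrite (_ : (fun x => _) = sq xi eta \+
    (fun x => r / c * (\1_A \* (xi \- eta)) x)); last first.
    by apply/funext => x /=; rewrite /sq mulrA.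
  apply: le_trans (rP.2 _ (bounded_mfunD FS F2)).
  rewrite lP.1// lP.2// -/c divfK ?gt_eqF// lerDr.
  by apply: mean_positive => // x; exact: sqr_ge0.
apply: ereal_sup_ubound; exists (fun x => r / c * \1_A x) => //.
split; first exact: bounded_mfunZ.
by move=> x; rewrite mulr_ge0// indicE.
Qed.

Context (P0 : probability T R).
Hypothesis rep_P0 : forall P, representation_set rho P -> P `<< P0.
Hypothesis P0_rep : forall P, representation_set rho P -> P0 `<< P.

(** The feasible set of the problem.  The two absolute continuities carry the
    inequalities between P, where conditional expectations live, and P0, where
    the essential supremum lives. *)
Lemma dominates_ess_supP xi eta_ess eta : FF xi -> FC eta ->
  is_ess_sup P0 (cond_exps rho C xi) (EFin \o eta_ess) ->
  dominates_cond_exps xi eta <-> {ae P0, forall x, eta_ess x <= eta x}.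
Proof.
move=> Fxi FCeta [_ ess_ub ess_min]; split => [dom|le P rP].
  have : {ae P0, forall x, ((EFin \o eta_ess) x <= (EFin \o eta) x)%E}.
    apply: ess_min => [|X [P rP ceX]].
      by apply/measurable_EFinP; exact: (FCF FCeta).1.
    have := (cond_exp_leP subC Fxi FCeta ceX).2 (dom P rP).
    by move=> /(dominates_ae (P0_rep rP)).
  by apply: filterS => x.
have [X ceX] := cond_exp_exists P subC Fxi.
apply/(cond_exp_leP subC Fxi FCeta ceX).
apply: dominates_ae (rep_P0 rP) _.
have SX : cond_exps rho C xi X by exists P.
apply: filterS2 (ess_ub _ SX) le => x; rewrite /= lee_fin; exact: le_trans.
Qed.

(** Conditionally on C the mean square error is a quadratic in the predictor
    whose minimizer E_P [xi | C] lies to the left of e <= eta.  Quantitatively,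
    (xi - e) ^ 2 = (xi - eta) ^ 2 - (eta - e) ^ 2 + 2 (eta - e) (xi - e), and
    the last term has nonpositive expectation under every P by
    [nonneg_multiplier].  The inequality is taken at a P that attains rho on
    the left. *)
Lemma rho_sq_gap xi e eta : FF xi -> FC e -> FC eta ->
  dominates_cond_exps xi e -> {ae P0, forall x, e x <= eta x} ->
  rho (fun x => (xi x - e x) ^+ 2) <=
  rho (fun x => (xi x - eta x) ^+ 2 - (eta x - e x) ^+ 2).
Proof.
move=> Fxi FCe FCeta dom le; have Fe := FCF FCe; have Feta := FCF FCeta.
have [P rP <-] := representation_attained rho_sublinear rho_cont (Fsq Fxi Fe).
pose g : T -> R := eta \- e; pose gp : T -> R := g \max cst 0.
(* eta - e is nonnegative only almost surely; its positive part is so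
   everywhere and has the same expectations. *)
have FCg : FC g by exact: bounded_mfunB.
have FCgp : FC gp by apply: bounded_mfun_max => //; exact: bounded_mfun_cst.
have FB := bounded_mfunB Fxi Fe.
have gp0 x : 0 <= gp x by rewrite /gp /= le_max lexx orbT.
have := nonneg_multiplier (mean_linear P) (@mean_positive _ _ _ P) FB
  (dom P rP) FCgp gp0.
have -> : fine ('E_P[(gp \* (xi \- e))%R])%E = fine ('E_P[(g \* (xi \- e))%R])%E.
  apply: mean_ae_eq;
    [exact: bounded_mfunM (FCF _) FB|exact: bounded_mfunM (FCF _) FB|].
  apply: dominates_ae (rep_P0 rP) _; move: le; apply: filterS => x le.
  by rewrite /gp /= (max_idPl _)// /g /= subr_ge0.
move=> le0; have FgB := bounded_mfunM (FCF FCg) FB.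
have FD := bounded_mfunB (Fsq Fxi Feta) (Fsq Feta Fe).
apply: le_trans (rP.2 _ FD).
rewrite (_ : sq xi e = (sq xi eta \- sq eta e) \+ (fun x => 2 * (g \* (xi \- e)) x)).
  rewrite (mean_linear P).1 ?(mean_linear P).2//; last exact: bounded_mfunZ.
  rewrite /sq /=; lra.
by apply/funext => x; rewrite /sq /g /=; ring.
Qed.

End Objective.

Theorem proposition5p5 (R : realType) (d : measure_display)
    (T : measurableType d) (C : set (set T)) (rho : (T -> R) -> R)
    (P0 : probability T R) (Fn : nat -> set (set T)) (xi : T -> R) :
  is_sub_sigma_algebra C ->
  sublinear_operator rho ->
  continuous_from_above rho ->
  reference_measure rho P0 ->
  strictly_comparable rho P0 ->
  filtration Fn ->
  stable rho P0 Fn ->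
  bounded_mfun T R xi ->
  (exists2 eta_ess, bounded_mfun (g_sigma_algebraType C) R eta_ess &
     is_ess_sup P0 (cond_exps rho C xi) (EFin \o eta_ess)) /\
  (forall eta_ess, bounded_mfun (g_sigma_algebraType C) R eta_ess ->
     is_ess_sup P0 (cond_exps rho C xi) (EFin \o eta_ess) ->
     is_solution rho C xi eta_ess /\
     (forall eta, is_solution rho C xi eta -> eta = eta_ess %[ae P0])).
Proof.
move=> subC rho_sl rho_cont [rep_P0 _] sc _ _ Fxi.
have P0_rep P : representation_set rho P -> P0 `<< P.
  exact: strictly_comparable_dominates.
split.
  have [M _ xiM] := bounded_mfun_bound Fxi.
  apply: (@ess_sup_exists _ _ _ _ _ _ _ M) => //.
  - have [P rP _] := representation_attained rho_sl rho_cont Fxi.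
    by have [X ceX] := cond_exp_exists P subC Fxi; exists X, P.
  - by move=> X [P _ []].
  - move=> X [P rP ceX]; apply: dominates_ae (P0_rep P rP) _.
    exact: cond_exp_bounded xiM ceX.
move=> e FCe ess_e.
have FCF (W : T -> R) :
    bounded_mfun (g_sigma_algebraType C) R W -> bounded_mfun T R W.
  exact/bounded_mfun_sub/subC.2.
have Fe := FCF _ FCe.
have dominatesP eta FCeta :=
  @dominates_ess_supP _ _ _ _ _ subC _ rep_P0 P0_rep xi e eta Fxi FCeta ess_e.
have dom_e : dominates_cond_exps rho C xi e.
  by apply/dominatesP => //; apply: aeW => x; exact: lexx.
have gap eta FCeta := @rho_sq_gap _ _ _ _ _ subC rho_sl rho_cont _ rep_P0 xi e eta
  Fxi FCe FCeta dom_e.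
have obj_e := objective_dominating subC rho_sl rho_cont Fxi FCe dom_e.
have FD eta : bounded_mfun T R eta ->
    bounded_mfun T R (fun x => (xi x - eta x) ^+ 2 - (eta x - e x) ^+ 2).
  move=> Feta; have F1 := bounded_mfunB Fxi Feta; have F2 := bounded_mfunB Feta Fe.
  exact: bounded_mfunB (bounded_mfunM F1 F1) (bounded_mfunM F2 F2).
have FS eta : bounded_mfun T R eta ->
    bounded_mfun T R (fun x => (xi x - eta x) ^+ 2).
  by move=> Feta; have F1 := bounded_mfunB Fxi Feta; exact: (bounded_mfunM F1 F1).
split.
  split => //; apply/eqP; rewrite eq_le; apply/andP; split; last first.
    by apply: ereal_inf_lbound; exists e.
  apply: le_ereal_inf_tmp => _ [eta FCeta <-].
  have Feta := FCF _ FCeta.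
  have [dom|ndom] := pselect (dominates_cond_exps rho C xi eta); last first.
    by rewrite (objective_not_dominating subC Fxi FCeta ndom) leey.
  rewrite obj_e (objective_dominating subC rho_sl rho_cont Fxi FCeta dom).
  rewrite lee_fin; have le := (dominatesP _ FCeta).1 dom.
  apply: le_trans (gap _ FCeta le) _.
  have [rho_mono _ _ _] := rho_sl.
  apply: rho_mono; [exact: FS|exact: FD|].
  by move=> x; rewrite gerBl sqr_ge0.
move=> eta [FCeta obj_eta]; have Feta := FCF _ FCeta.
have obj_le : (objective rho C xi eta <= objective rho C xi e)%E.
  by rewrite obj_eta; apply: ereal_inf_lbound; exists e.
have dom : dominates_cond_exps rho C xi eta.
  apply: contrapT => ndom; move: obj_le.
  by rewrite (objective_not_dominating subC Fxi FCeta ndom) obj_e leye_eq.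
have le := (dominatesP _ FCeta).1 dom.
have mlt : measurable [set x : T | e x < eta x].
  exact: (measurable_set_lt Fe.1 Feta.1).
have lt0 : P0 [set x : T | e x < eta x] = 0%E.
  apply/eqP/negPn/negP => ne0.
  move: obj_le; rewrite obj_e.
  rewrite (objective_dominating subC rho_sl rho_cont Fxi FCeta dom).
  rewrite lee_fin leNgt => /negP; apply.
  apply: le_lt_trans (gap _ FCeta le) _.
  apply: sc; [exact: FS|exact: FD| |].
    by apply: aeW => x; rewrite gerBl sqr_ge0.
  apply: lt_le_trans (_ : (P0 [set x : T | (e x < eta x)%R] <= _)%E).
    by rewrite lt0e ne0 measure_ge0.
  apply: le_measure; rewrite ?inE//.
    exact: (measurable_set_lt (FD _ Feta).1 (FS _ Feta).1).
  by move=> x /= lt; rewrite gtrBl exprn_gt0// subr_gt0.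
have ge : {ae P0, forall x : T, eta x <= e x}.
  exists [set x : T | e x < eta x]; split => // x /= /negP.
  by rewrite -ltNge.
by apply: filterS2 le ge => x le ge _; apply/eqP; rewrite eq_le le ge.
Qed.
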